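(* Let $G$ be a finite, simple, connected graph with vertex set $V$, maximum degree $m$, and an involution $\sigma$. Let $v\in V$ with $v':=\sigma(v)\ne v$ and $d=d(v,v')$. Let $H=A_G+D_Q$ with potential $Q$ at $v$ and $v'$ and $0$ elsewhere. For every (small) $\epsilon\in(0,1)$, if $$Q\ge \frac{256\,(m+1)}{\epsilon^2},$$ then there exists a time $t$ with $0<t<\frac{\pi}{2}(Q+m)^{d-1}$ such that $p(t)\ge 1-\epsilon$.
   Context: $A_G$ is the adjacency matrix of $G$ and $D_Q$ is the diagonal matrix of the potential. An involution of $G$ is a bijection $\sigma:V\to V$ with $\sigma\circ\sigma=\mathrm{id}$ such that $x\sim y$ implies $\sigma(x)\sim\sigma(y)$. The transfer probability from $v$ to $v'$ at time $t$ is $p(t)=|\langle e_v, e^{itH} e_{v'}\rangle|^2$, where $e_x$ is the standard basis vector of vertex $x$. *)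

(* Defs.v *)
From HB Require Import structures.
From mathcomp Require Import all_boot all_order all_algebra.
From mathcomp Require Import all_classical all_reals all_analysis.
Set Implicit Arguments. Unset Strict Implicit. Unset Printing Implicit Defensive.
Import Order.TTheory GRing.Theory Num.Theory numFieldNormedType.Exports.
Local Open Scope ring_scope.

Definition simple_graph n (e : rel 'I_n) : Prop :=
  symmetric e /\ irreflexive e.

Definition connected_graph n (e : rel 'I_n) : Prop :=
  forall x y : 'I_n, connect e x y.

Definition max_degree n (e : rel 'I_n) : nat :=
  (\max_(x : 'I_n) #|[set y | e x y]|)%N.

Definition graph_involution n (e : rel 'I_n) (s : 'I_n -> 'I_n) : Prop :=
  (forall x, s (s x) = x) /\ (forall x y, e x y -> e (s x) (s y)).

Definition graph_dist n (e : rel 'I_n) (x y : 'I_n) (d : nat) : Prop :=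
  (exists p : seq 'I_n, size p = d /\ path e x p /\ last x p = y) /\
  (forall p : seq 'I_n, path e x p -> last x p = y -> (d <= size p)%N).

Definition adjmx (R : numDomainType) n (e : rel 'I_n) : 'M[R]_n :=
  \matrix_(i, j) (e i j)%:R.

Definition hamiltonian (R : numDomainType) n (e : rel 'I_n) (v v' : 'I_n) (Q : R)
  : 'M[R]_n :=
  adjmx R e + \matrix_(i, j) (if (i == j) && ((i == v) || (i == v')) then Q else 0).

(* matrix powers (valid for every n, including n = 0) *)
Definition mxpow (R : numDomainType) n (M : 'M[R]_n) (k : nat) : 'M[R]_n :=
  iter k (mulmx M) 1%:M.

(* e^{itH} = sum_k (i t)^k / k! H^k ; real and imaginary parts of entry (x,y),
   using Re(i^k) = [k even] (-1)^(k/2), Im(i^k) = [k odd] (-1)^((k-1)/2). *)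
Definition expitH_re (R : realType) n (H : 'M[R]_n) (t : R) (x y : 'I_n) : R :=
  limn (series (fun k : nat =>
     ((if odd k then 0 else (-1) ^+ k./2) * t ^+ k / (k`!)%:R * mxpow H k x y))).

Definition expitH_im (R : realType) n (H : 'M[R]_n) (t : R) (x y : 'I_n) : R :=
  limn (series (fun k : nat =>
     ((if odd k then (-1) ^+ k./2 else 0) * t ^+ k / (k`!)%:R * mxpow H k x y))).

Definition transfer_prob (R : realType) n (H : 'M[R]_n) (x y : 'I_n) (t : R) : R :=
  expitH_re H t x y ^+ 2 + expitH_im H t x y ^+ 2.

(* Main.v *)
Require Import Defs.
From HB Require Import structures.
From mathcomp Require Import all_boot all_order all_algebra.
From mathcomp Require Import all_classical all_reals all_analysis.
From mathcomp Require Import ring lra.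
From mathcomp.real_closed Require Import complex.
Set Implicit Arguments. Unset Strict Implicit. Unset Printing Implicit Defensive.
Import Order.TTheory GRing.Theory Num.Theory numFieldNormedType.Exports.
Local Open Scope ring_scope.

(** Let [w = s v].  In an eigenbasis of [H], the amplitude from [v] to [w] is a quarter
    of the difference of the Fourier transforms at [t] of the spectral measures of
    [e_v + e_w] and [e_v - e_w].  As [H - Q] sends each of these vectors to one of
    squared norm at most [4 m], Chebyshev's inequality puts nearly all the mass above
    [Q / 2].  There, a maximum principle for [l f - A f] off [{v, w}], valid for [l > m],
    shows that the values of an eigenfunction at [v] and [w] determine its eigenvalue; so
    each of the two measures is almost an atom, at [L1] and [L2] respectively, and the
    transfer probability is almost [sin (t (L1 - L2) / 2) ^ 2].

    To bound the gap below, let [f1] and [f2] be the eigenfunctions with values [(1, 1)]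
    and [(1, -1)] at [(v, w)], and let [b = (f1 + f2) / 2].  Then [L1 - L2] is twice the
    sum of [b] over the neighbours of [w].  Raised by a constant of order
    [(L1 - L2) m / Q ^ 2], the function [b] is a positive supersolution at [L2], so it
    drops by a factor of at most [L2 <= Q + m] along each edge of a shortest path from
    [v], where [b = 1], to [w]. *)

(** * Graphs *)

Lemma graph_dist_path n (e : rel 'I_n) v w d :
  w != v -> graph_dist e v w d ->
  exists q, [/\ size q = d.-1, path e v q, e (last v q) w &
                {in q, forall x, x \notin [set v; w]}].
Proof.
move=> wv [[p [<- [ep lastp]]] shortest]; move: lastp (shortest).
case: (shortenP ep) => p' ep' uniq_p' p'p lastp' /(_ p' ep' lastp') size_p.
have {size_p} size_p' : size p' = size p.
  by apply/eqP; rewrite eqn_leq size_p uniq_leq_size //; case/andP: uniq_p'.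
case/lastP: p' => [|q x] in ep' uniq_p' lastp' size_p' p'p *.
  by rewrite -lastp' eqxx in wv.
rewrite last_rcons in lastp'; rewrite lastp' in ep' uniq_p' size_p'.
rewrite rcons_path in ep'; have [epq qw] := andP ep'.
exists q; split=> //; first by rewrite -size_p' size_rcons.
move: uniq_p'; rewrite /= mem_rcons inE negb_or rcons_uniq.
move=> /and3P[/andP[_ vq] wq _] y yq.
by apply/set2P => -[] yE; rewrite yE ?(negPf vq) ?(negPf wq) in yq.
Qed.

Lemma graph_involution_mono n (e : rel 'I_n) s :
  graph_involution e s -> {mono s : x y / e x y}.
Proof. by move=> [sK es] x y; apply/idP/idP => [/es|/es //]; rewrite !sK. Qed.

Lemma degree_le_max_degree (R : numDomainType) n (e : rel 'I_n) x :
  #|[set y | e x y]|%:R <= (max_degree e)%:R :> R.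
Proof. by rewrite ler_nat (leq_bigmax (F := fun x => #|[set y | e x y]|)). Qed.

(** * Maximum principle and eigenfunctions *)

Section MaximumPrinciple.
Variables (R : realFieldType) (T : finType) (e : rel T) (m : R).
Hypothesis degree_le : forall x, #|[set y | e x y]|%:R <= m.
Implicit Types (S : {set T}) (f : T -> R) (l K Q : R).

Lemma degree_bound_ge0 (x : T) : 0 <= m.
Proof. exact: le_trans (ler0n _ _) (degree_le x). Qed.

Lemma sum_nbrs_le f K x :
  0 <= K -> (forall y, f y <= K) -> \sum_(y | e x y) f y <= m * K.
Proof.
move=> K0 fK; apply: (@le_trans _ _ (\sum_(y | e x y) K)); first exact: ler_sum.
by rewrite sumr_const -[leLHS]mulr_natl ler_wpM2r // -cardsE; apply: degree_le.
Qed.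

Lemma norm_sum_nbrs_le f K x :
  (forall y, `|f y| <= K) -> `|\sum_(y | e x y) f y| <= m * K.
Proof.
move=> fK; apply: le_trans (ler_norm_sum _ _ _) _.
by apply: sum_nbrs_le => //; exact: le_trans (fK x).
Qed.

Lemma sum_adj_le x : \sum_y (e x y)%:R <= m.
Proof.
rewrite -[m]mulr1; apply: le_trans (sum_nbrs_le (f := fun=> 1) x ler01 _) => //.
by rewrite [leRHS]big_mkcond; apply: ler_sum => y _; case: (e x y).
Qed.

Lemma maximum_principle S l K f :
  m < l -> {in S, forall x, `|f x| <= K} ->
  (forall x, x \notin S ->
     `|l * f x - \sum_(y | e x y) f y| <= K * (l - m)) ->
  forall x, `|f x| <= K.
Proof.
move=> ml fS fint x; have m0 := degree_bound_ge0 x.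
pose z := [arg max_(i > x) `|f i|]%O.
have fz y : `|f y| <= `|f z| by rewrite /z; case: arg_maxP => // i _; apply.
apply: le_trans (fz x) _; have [/fS //|/fint fzS] := boolP (z \in S).
have lz : l * `|f z| <= K * (l - m) + m * `|f z|.
  rewrite -[l in l * _]gtr0_norm ?(le_lt_trans m0) // -normrM.
  rewrite -[l * f z](subrK (\sum_(y | e z y) f y)).
  by apply: le_trans (ler_normD _ _) _; apply: lerD => //; apply: norm_sum_nbrs_le.
rewrite -(ler_pM2r (_ : 0 < l - m)) ?subr_gt0 //; lra.
Qed.

Definition supersolution l S f :=
  forall x, x \notin S -> \sum_(y | e x y) f y <= l * f x.

Lemma minimum_principle S l f :
  m < l -> supersolution l S f -> {in S, forall x, 0 <= f x} ->
  forall x, 0 <= f x.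
Proof.
move=> ml fsup fS x; pose z := [arg min_(i < x) f i]%O.
have fz y : f z <= f y by rewrite /z; case: arg_minP => // i _; apply.
apply: le_trans (fz x); rewrite leNgt; apply/negP => fz0.
have /fsup : z \notin S by apply: contraL fz0 => /fS; rewrite leNgt.
have : \sum_(y | e z y) - f y <= m * - f z.
  by apply: sum_nbrs_le => [|y]; rewrite ?lerN2 // oppr_ge0 ltW.
have : m * f z > l * f z by rewrite ltr_nM2r.
rewrite sumrN; lra.
Qed.

Lemma supersolution_path S l f x q :
  symmetric e -> 0 <= l -> (forall y, 0 <= f y) -> supersolution l S f ->
  path e x q -> {in q, forall y, y \notin S} ->
  f x <= l ^+ size q * f (last x q).
Proof.
move=> esym l0 f0 fsup; elim: q x => [|y q IH] x /=; first by rewrite mul1r.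
move=> /andP[exy pq] qS.
have /fsup fy : y \notin S by apply: qS; rewrite mem_head.
have fxy : f x <= l * f y.
  apply: le_trans fy; rewrite esym in exy.
  by rewrite (bigD1 x) //= lerDl sumr_ge0.
apply: le_trans fxy _; rewrite exprS -mulrA ler_wpM2l // IH // => z zq.
by apply: qS; rewrite inE zq orbT.
Qed.

Lemma supersolution_path_sum_nbrs S l f v w q :
  symmetric e -> 0 <= l -> (forall y, 0 <= f y) -> supersolution l S f ->
  path e v q -> {in q, forall y, y \notin S} -> e (last v q) w ->
  f v <= l ^+ size q * \sum_(y | e w y) f y.
Proof.
move=> esym l0 f0 fsup pq qS; rewrite esym => qw.
apply: le_trans (supersolution_path esym l0 f0 fsup pq qS) _.
rewrite ler_wpM2l ?exprn_ge0 // (bigD1 (last v q)) //=.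
by rewrite lerDl sumr_ge0.
Qed.

(* [A f + Q 1_S f = l f], with [A] the adjacency operator. *)
Definition eigenfunction S Q l f :=
  forall x, \sum_(y | e x y) f y = (l - Q *+ (x \in S)) * f x.

Lemma eigenfunction_interior S Q l f x :
  eigenfunction S Q l f -> x \notin S -> \sum_(y | e x y) f y = l * f x.
Proof. by move=> -> /negPf ->; rewrite subr0. Qed.

Lemma eigenfunction_lin S Q l f g a b :
  eigenfunction S Q l f -> eigenfunction S Q l g ->
  eigenfunction S Q l (fun x => a * f x + b * g x).
Proof.
by move=> ef eg x; rewrite big_split /= -!mulr_sumr ef eg; ring.
Qed.

Lemma eigenfunction_comp S Q l f (s : T -> T) :
  involutive s -> {mono s : x y / e x y} -> {mono s : x / x \in S} ->
  eigenfunction S Q l f -> eigenfunction S Q l (f \o s).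
Proof.
move=> sK es sS ef x; rewrite -sS -ef [RHS](reindex_inj (can_inj sK)) /=.
by apply: eq_bigl => y; rewrite es.
Qed.

Section LargeEigenvalue.
Variables (S : {set T}) (Q l K : R) (f : T -> R).
Hypotheses (ml : m < l) (ef : eigenfunction S Q l f).
Hypotheses (K0 : 0 <= K) (fS : {in S, forall x, `|f x| <= K}).

Lemma eigenfunction_norm_le x : `|f x| <= K.
Proof.
apply: (maximum_principle ml fS) => y yS.
rewrite (eigenfunction_interior ef) // subrr normr0 mulr_ge0 //.
by rewrite subr_ge0 ltW.
Qed.

Lemma eigenfunction_interior_norm_le x : x \notin S -> l * `|f x| <= m * K.
Proof.
move=> xS; have l0 : 0 < l := le_lt_trans (degree_bound_ge0 x) ml.
rewrite -[l]gtr0_norm // -normrM -(eigenfunction_interior ef) //.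
exact/norm_sum_nbrs_le/eigenfunction_norm_le.
Qed.

End LargeEigenvalue.

Lemma eigenvalue_le S Q l K f x :
  m < l -> eigenfunction S Q l f -> {in S, forall y, `|f y| <= K} ->
  x \in S -> f x = K -> 0 < K -> l <= Q + m.
Proof.
move=> ml ef fS xS fx K0; rewrite -lerBlDl -(ler_pM2r K0).
have := ef x; rewrite xS fx => <-.
apply: le_trans (ler_norm _) (norm_sum_nbrs_le x _).
exact: eigenfunction_norm_le ml ef (ltW K0) fS.
Qed.

(* An eigenfunction [f] for [l1] that is bounded by [1] on [S] is at most [m / l1]
   off [S]; hence the solution of [(l2 - A) g = f] off [S] that vanishes on [S] is at
   most [response l1 l2]. *)
Definition response l1 l2 : R := m / (l1 * (l2 - m)).

Lemma response_ge0 l1 l2 : 0 <= m -> m < l1 -> m < l2 -> 0 <= response l1 l2.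
Proof. by move=> m0 ml1 ml2; rewrite divr_ge0 // mulr_ge0 //; lra. Qed.

Lemma mul_response_lt1 l1 l2 :
  0 <= m -> 2 * m < l1 -> 2 * m < l2 -> m * response l1 l2 < 1.
Proof.
move=> m0 ml1 ml2; have l12 : 0 < l1 * (l2 - m) by rewrite mulr_gt0 //; lra.
rewrite mulrA ltr_pdivrMr // mul1r.
by apply: (@le_lt_trans _ _ (l1 * m)); rewrite ?ler_wpM2r ?ltr_pM2l //; lra.
Qed.

Lemma eigenvalue_shift_le S Q l1 l2 f x :
  m < l1 -> m < l2 -> eigenfunction S Q l1 f ->
  {in S, forall y, `|f y| <= 1} -> x \notin S ->
  `|(l1 - l2) * f x| <= `|l1 - l2| * response l1 l2 * (l2 - m).
Proof.
move=> ml1 ml2 ef fS xS; have m0 := degree_bound_ge0 x.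
have -> : `|l1 - l2| * response l1 l2 * (l2 - m) = `|l1 - l2| * (m / l1).
  by rewrite /response; field; rewrite !gt_eqF //; lra.
rewrite normrM ler_wpM2l // ler_pdivlMr ?(le_lt_trans m0) // mulrC -[m]mulr1.
exact: eigenfunction_interior_norm_le ml1 ef ler01 fS x xS.
Qed.

Lemma eq_boundary_eigenvalue S Q l1 l2 f1 f2 x :
  2 * m < l1 -> 2 * m < l2 ->
  eigenfunction S Q l1 f1 -> eigenfunction S Q l2 f2 ->
  {in S, f1 =1 f2} -> {in S, forall y, `|f1 y| <= 1} ->
  x \in S -> f1 x = 1 -> l1 = l2.
Proof.
move=> ml1 ml2 ef1 ef2 f12 f1S xS f1x; have m0 := degree_bound_ge0 x.
have [m1 m2] : m < l1 /\ m < l2 by lra.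
pose g y := f1 y - f2 y; pose K := `|l1 - l2| * response l1 l2.
have gK : forall y, `|g y| <= K.
  apply: (maximum_principle (S := S) m2) => y yS.
    by rewrite /g f12 // subrr normr0 mulr_ge0 // response_ge0.
  rewrite sumrB (eigenfunction_interior ef1) // (eigenfunction_interior ef2) //.
  rewrite (_ : _ - _ = - ((l1 - l2) * f1 y)); last by rewrite /g; ring.
  by rewrite normrN; apply: eigenvalue_shift_le ef1 f1S yS.
have l12 : l1 - l2 = \sum_(y | e x y) g y.
  by rewrite sumrB ef1 ef2 xS -f12 // f1x; ring.
have := norm_sum_nbrs_le x gK; rewrite -l12 /K mulrCA.
have [-> //|l12N] := eqVneq l1 l2.
by rewrite ler_pMr ?normr_gt0 ?subr_eq0 // leNgt mul_response_lt1.
Qed.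

(* Off [S] the mean [b] satisfies [A b = l2 b + (l1 - l2) / 2 f1], and the constant
   absorbs the last term. *)
Lemma eigenfunction_mean_supersolution S Q l1 l2 f1 f2 :
  m < l1 -> m < l2 -> eigenfunction S Q l1 f1 -> eigenfunction S Q l2 f2 ->
  {in S, forall x, `|f1 x| <= 1} ->
  supersolution l2 S
    (fun x => (f1 x + f2 x) / 2 + `|l1 - l2| * response l1 l2 / 2).
Proof.
move=> ml1 ml2 ef1 ef2 f1S x xS; have m0 := degree_bound_ge0 x.
set K := `|_| * _.
have K0 : 0 <= K / 2 by rewrite divr_ge0 // mulr_ge0 // response_ge0.
have drift : (l1 - l2) * f1 x <= K * (l2 - m).
  exact: le_trans (ler_norm _) (eigenvalue_shift_le ml1 ml2 ef1 f1S xS).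
have mK : \sum_(y | e x y) K / 2 <= m * (K / 2) by apply: sum_nbrs_le.
rewrite big_split /= -mulr_suml big_split /=.
rewrite (eigenfunction_interior ef1) // (eigenfunction_interior ef2) //.
lra.
Qed.

(* For [w] the mirror image of [v], [c = 1] and [c = -1] are the two parities. *)
Definition parity_eigenfunction v w Q c l f : Prop :=
  [/\ eigenfunction [set v; w] Q l f, f v = 1 & f w = c].

Lemma parity_eigenfunction_symmetrization s v Q c l f :
  involutive s -> {mono s : x y / e x y} -> c ^+ 2 = 1 ->
  eigenfunction [set v; s v] Q l f -> f v + c * f (s v) != 0 ->
  exists g, parity_eigenfunction v (s v) Q c l g.
Proof.
move=> sK es c2 ef; set b := _ + _ => b0.
have sS : {mono s : x / x \in [set v; s v]}.
  by move=> x; rewrite !inE (inv_eq sK) (can_eq sK) orbC.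
exists (fun x => b^-1 * f x + b^-1 * c * (f \o s) x); split.
- exact: eigenfunction_lin ef (eigenfunction_comp sK es sS ef).
- by rewrite -mulrA -mulrDr mulVf.
- have fsv : f (s v) + c * f v = c * b.
    by rewrite /b mulrDr mulrA -expr2 c2 mul1r addrC.
  by rewrite /= sK -mulrA -mulrDr fsv mulrCA mulVf ?mulr1.
Qed.

Lemma parity_eigenfunction_norm_le1 v w Q c l f :
  `|c| <= 1 -> parity_eigenfunction v w Q c l f ->
  {in [set v; w], forall x, `|f x| <= 1}.
Proof. by move=> c1 [_ fv fw] x /set2P[] ->; rewrite ?fv ?fw ?normr1. Qed.

Lemma parity_eigenvalue_le v w Q c l f :
  `|c| <= 1 -> m < l -> parity_eigenfunction v w Q c l f -> l <= Q + m.
Proof.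
move=> c1 ml pf; have fS := parity_eigenfunction_norm_le1 c1 pf.
by have [ef fv _] := pf; apply: (eigenvalue_le ml ef fS (set21 v w) fv ltr01).
Qed.

Lemma parity_eigenvalue_unique v w Q c l1 l2 f1 f2 :
  `|c| <= 1 -> 2 * m < l1 -> 2 * m < l2 ->
  parity_eigenfunction v w Q c l1 f1 -> parity_eigenfunction v w Q c l2 f2 ->
  l1 = l2.
Proof.
move=> c1 ml1 ml2 pf1 [ef2 f2v f2w]; have [ef1 f1v f1w] := pf1.
apply: (eq_boundary_eigenvalue ml1 ml2 ef1 ef2 _ _ (set21 v w) f1v).
  by move=> x /set2P[] ->; rewrite ?f1v ?f2v ?f1w ?f2w.
exact: parity_eigenfunction_norm_le1 c1 pf1.
Qed.

Lemma parity_gap_norm v w Q l1 l2 f1 f2 q :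
  symmetric e -> m < l1 -> m < l2 ->
  parity_eigenfunction v w Q 1 l1 f1 -> parity_eigenfunction v w Q (-1) l2 f2 ->
  path e v q -> {in q, forall x, x \notin [set v; w]} -> e (last v q) w ->
  2 / (Q + m) ^+ size q <= (l1 - l2) + m * response l1 l2 * `|l1 - l2|.
Proof.
move=> esym ml1 ml2 pf1 pf2 pq qS qw; have m0 := degree_bound_ge0 v.
have [[ef1 f1v f1w] [ef2 f2v f2w]] := (pf1, pf2).
have l2Q : l2 <= Q + m.
  by apply: (parity_eigenvalue_le _ _ pf2); rewrite // normrN normr1.
pose K := `|l1 - l2| * response l1 l2 / 2.
have K0 : 0 <= K by rewrite divr_ge0 // mulr_ge0 // response_ge0.
pose g x := (f1 x + f2 x) / 2 + K.
have gv : g v = 1 + K by rewrite /g f1v f2v; lra.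
have gw : g w = K by rewrite /g f1w f2w; lra.
have gsup : supersolution l2 [set v; w] g.
  apply: (eigenfunction_mean_supersolution ml1 ml2 ef1 ef2).
  by apply: parity_eigenfunction_norm_le1 pf1; rewrite normr1.
have g0 : forall x, 0 <= g x.
  apply: (minimum_principle ml2 gsup) => x /set2P[] ->; last by rewrite gw.
  by rewrite gv; lra.
have sum_gw : \sum_(y | e w y) g y <= (l1 - l2) / 2 + m * K.
  rewrite big_split /= -mulr_suml big_split /= ef1 ef2 f1w f2w set22.
  by apply: lerD (sum_nbrs_le w K0 _) => //; lra.
have path_le : 1 <= (Q + m) ^+ size q * \sum_(y | e w y) g y.
  apply: (@le_trans _ _ (g v)); first lra.
  have l20 : 0 <= l2 by lra.
  apply: le_trans (supersolution_path_sum_nbrs esym l20 g0 gsup pq qS qw) _.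
  by rewrite ler_wpM2r ?sumr_ge0 // lerXn2r ?nnegrE //; lra.
have Qm : 0 < (Q + m) ^+ size q by rewrite exprn_gt0 //; lra.
rewrite ler_pdivrMr //.
have : 1 <= (Q + m) ^+ size q * ((l1 - l2) / 2 + m * K).
  by apply: le_trans path_le _; rewrite ler_pM2l.
rewrite /K; lra.
Qed.

Lemma parity_gap v w Q l1 l2 f1 f2 q :
  symmetric e -> 2 * m < l1 -> 2 * m < l2 ->
  parity_eigenfunction v w Q 1 l1 f1 -> parity_eigenfunction v w Q (-1) l2 f2 ->
  path e v q -> {in q, forall x, x \notin [set v; w]} -> e (last v q) w ->
  0 < l1 - l2 /\
  2 / (Q + m) ^+ size q <= (1 + m * response l1 l2) * (l1 - l2).
Proof.
move=> esym ml1 ml2 pf1 pf2 pq qS qw; have m0 := degree_bound_ge0 v.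
have [m1 m2] : m < l1 /\ m < l2 by lra.
have l2Q : l2 <= Q + m.
  by apply: (parity_eigenvalue_le _ _ pf2); rewrite // normrN normr1.
have Qm : 0 < 2 / (Q + m) ^+ size q by rewrite divr_gt0 ?exprn_gt0 //; lra.
have := parity_gap_norm esym m1 m2 pf1 pf2 pq qS qw.
have r1 := mul_response_lt1 m0 ml1 ml2.
have := mulr_ge0 m0 (response_ge0 m0 m1 m2).
set r := m * _ in r1 * => r0; case: ger0P => [_|gap_lt0] gap_norm.
  have gap : 2 / (Q + m) ^+ size q <= (1 + r) * (l1 - l2) by lra.
  split=> //; rewrite -(@pmulr_rgt0 _ (1 + r)); lra.
have : (l1 - l2) * (1 - r) <= 0 by rewrite mulr_le0_ge0 //; lra.
lra.
Qed.

End MaximumPrinciple.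

(** * Eigenframes of symmetric matrices *)

(* The rows of [U] are eigenvectors of [H] forming a Parseval frame; [k] may exceed
   [n], so that the rows need not be orthogonal. *)
Definition eigenframe (R : numDomainType) n k (H : 'M[R]_n) (U : 'M[R]_(k, n))
    (l : 'rV[R]_k) : Prop :=
  U^T *m U = 1%:M /\ U *m H = diag_mx l *m U.

Section SymmetricMatrix.
Variable R : rcfType.

Lemma scale_Rcomplex (a : R) (z : R[i]) : a *: (z : Rcomplex R) = a%:C%C * z.
Proof. by case: z => b c; rewrite /GRing.scale /=; simpc. Qed.

Lemma map_scalar_mulmx_real (f : {scalar Rcomplex R}) p n k
    (M : 'M[R[i]]_(p, n)) (N : 'M[R]_(n, k)) :
  map_mx f (M *m map_mx (real_complex R) N) = map_mx f M *m N.
Proof.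
apply/matrixP => x y; rewrite !mxE [LHS](raddf_sum f); apply: eq_bigr => j _.
by rewrite !mxE mulrC -scale_Rcomplex [LHS](scalarZ f) mulrC.
Qed.

Lemma map_scalar_diag_mulmx_real (f : {scalar Rcomplex R}) p n
    (d : 'rV[R]_p) (M : 'M[R[i]]_(p, n)) :
  map_mx f (diag_mx (map_mx (real_complex R) d) *m M) = diag_mx d *m map_mx f M.
Proof.
apply/matrixP => x y; rewrite !mul_diag_mx !mxE -scale_Rcomplex.
exact: (scalarZ f).
Qed.

Lemma symmetric_spectral n (H : 'M[R]_n) : H^T = H ->
  exists (P : 'M[R[i]]_n) (d : 'rV[R]_n),
    (P^t* *m P)%sesqui = 1%:M /\
    P *m map_mx (real_complex R) H = diag_mx (map_mx (real_complex R) d) *m P.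
Proof.
move=> Hsym; set A := map_mx _ H.
have Aherm : A \is hermsymmx.
  apply: realsym_hermsym; last first.
    by apply/mxOverP => i j; rewrite mxE complex_real.
  by apply/is_hermitianmxP; rewrite expr0 scale1r map_mx_id // map_trmx Hsym.
exists (spectralmx A), (map_mx (@complex.Re R) (spectral_diag A)); split.
  by rewrite -invmx_unitary ?spectral_unitarymx // mulVmx // spectral_unit.
have -> : map_mx (real_complex R) (map_mx (@complex.Re R) (spectral_diag A))
    = spectral_diag A.
  apply/rowP => j; rewrite !mxE RRe_real //.
  by have /mxOverP := hermitian_spectral_diag_real Aherm.
have /hermitian_normalmx /orthomx_spectralP AE := Aherm.
by rewrite {2}AE !mulmxA mulmxV ?mul1mx // spectral_unit.
Qed.

(* The real and imaginary parts of a complex orthonormal eigenbasis. *)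
Lemma symmetric_eigenframe n (H : 'M[R]_n) : H^T = H ->
  exists (U : 'M[R]_(n + n, n)) (l : 'rV[R]_(n + n)), eigenframe H U l.
Proof.
move=> /symmetric_spectral[P [d [PP PH]]].
exists (col_mx (map_mx (@complex.Re R) P) (map_mx (@complex.Im R) P)).
exists (row_mx d d); split.
  rewrite tr_col_mx mul_row_col; apply/matrixP => x y.
  have := congr1 (fun M : 'M[R[i]]_n => complex.Re (M x y)) PP.
  rewrite !mxE (raddf_sum (@complex.Re R : {scalar Rcomplex R})) => PPxy.
  rewrite -[RHS](_ : complex.Re (x == y)%:R = _); last by case: (x == y).
  rewrite -PPxy -big_split; apply: eq_bigr => j _; rewrite !mxE /=.
  by case: (P j x) (P j y) => [a b] [a' b'] /=; ring.
rewrite mul_col_mx diag_mx_row mul_block_col !mul0mx addr0 add0r.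
by rewrite -!map_scalar_mulmx_real PH !map_scalar_diag_mulmx_real.
Qed.

End SymmetricMatrix.

Section EigenframeSums.
Variables (R : realDomainType) (n k : nat).
Variables (H : 'M[R]_n) (U : 'M[R]_(k, n)) (l : 'rV[R]_k).
Hypothesis frame : eigenframe H U l.

Lemma mxpow_eigenframe p x y :
  mxpow H p x y = \sum_j U j x * U j y * l 0 j ^+ p.
Proof.
have [UU UH] := frame.
have UHp : U *m mxpow H p = diag_mx (map_mx (fun z => z ^+ p) l) *m U.
  elim: p => [|p IH].
    by rewrite mulmx1; apply/matrixP => i j; rewrite mul_diag_mx !mxE mul1r.
  rewrite [mxpow H p.+1]/(H *m mxpow H p) mulmxA UH -mulmxA IH.
  by apply/matrixP => i j; rewrite !mul_diag_mx !mxE exprS mulrA.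
rewrite -[mxpow H p]mul1mx -UU -mulmxA UHp mul_diag_mx mxE.
by apply: eq_bigr => j _; rewrite !mxE; ring.
Qed.

Definition spectral_mass (a : 'cV[R]_n) (j : 'I_k) : R := (U *m a) j 0 ^+ 2.

Lemma spectral_mass_ge0 a j : 0 <= spectral_mass a j.
Proof. exact: sqr_ge0. Qed.

Lemma sum_spectral_mass a : \sum_j spectral_mass a j = (a^T *m a) 0 0.
Proof.
have [UU _] := frame; transitivity (((U *m a)^T *m (U *m a)) 0 0).
  by rewrite mxE; apply: eq_bigr => j _; rewrite /spectral_mass expr2 [_^T _ _]mxE.
by rewrite trmx_mul -mulmxA [U^T *m _]mulmxA UU mul1mx.
Qed.

Lemma spectral_mass_shift a c j :
  spectral_mass (H *m a - c *: a) j = (l 0 j - c) ^+ 2 * spectral_mass a j.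
Proof.
have [_ UH] := frame; rewrite /spectral_mass -exprMn; congr (_ ^+ 2).
by rewrite mulmxBr -scalemxAr mulmxA UH -mulmxA mul_diag_mx !mxE mulrBl.
Qed.

Definition pair_vec (v w : 'I_n) (c : R) : 'cV[R]_n :=
  delta_mx v 0 + c *: delta_mx w 0.

Lemma pair_vecE v w c x : pair_vec v w c x 0 = (x == v)%:R + c * (x == w)%:R.
Proof. by rewrite !mxE !andbT. Qed.

Lemma mulmx_pair_vec p (M : 'M[R]_(p, n)) v w c i :
  (M *m pair_vec v w c) i 0 = M i v + c * M i w.
Proof. by rewrite mulmxDr -scalemxAr -!colE !mxE. Qed.

Lemma sum_spectral_mass_pair v w c :
  w != v -> \sum_j spectral_mass (pair_vec v w c) j = 1 + c ^+ 2.
Proof.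
move=> /negPf wv; rewrite sum_spectral_mass mulmx_pair_vec ![_^T _ _]mxE.
by rewrite !pair_vecE !eqxx [v == w]eq_sym wv /=; ring.
Qed.

Lemma spectral_mass_polarization v w (g : 'I_k -> R) :
  4 * (\sum_j U j v * U j w * g j) =
  \sum_j spectral_mass (pair_vec v w 1) j * g j
  - \sum_j spectral_mass (pair_vec v w (-1)) j * g j.
Proof.
rewrite -sumrB mulr_sumr; apply: eq_bigr => j _.
by rewrite /spectral_mass !mulmx_pair_vec; ring.
Qed.

End EigenframeSums.

(** * Concentration of the spectral measures *)

Lemma chebyshev_sum (R : realDomainType) (J : finType) (W l : J -> R) c r :
  (forall j, 0 <= W j) -> 0 <= r ->
  r ^+ 2 * (\sum_(j | r <= `|l j - c|) W j) <= \sum_j (l j - c) ^+ 2 * W j.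
Proof.
move=> W0 r0; rewrite mulr_sumr [leRHS](bigID (fun j => r <= `|l j - c|)) /=.
apply: ler_wpDr; first by apply: sumr_ge0 => j _; rewrite mulr_ge0 ?sqr_ge0.
apply: ler_sum => j rl; rewrite ler_wpM2r //.
by rewrite -[leRHS]real_normK ?num_real // lerXn2r ?nnegrE.
Qed.

Lemma ler_sum_support (R : numDomainType) (J : finType) (P1 P2 : pred J)
    (W : J -> R) :
  (forall j, 0 <= W j) -> (forall j, P1 j -> W j != 0 -> P2 j) ->
  \sum_(j | P1 j) W j <= \sum_(j | P2 j) W j.
Proof.
move=> W0 P12; rewrite [leLHS]big_mkcond [leRHS]big_mkcond.
apply: ler_sum => j _; case: ifPn => [P1j|_]; last by case: ifP.
by case: ifPn => // /(contraNeq (P12 j P1j)) ->.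
Qed.

Section Hamiltonian.
Variables (R : numDomainType) (n : nat) (e : rel 'I_n) (v w : 'I_n) (Q : R).
Hypothesis esym : symmetric e.
Local Notation H := (hamiltonian e v w Q).

Lemma hamiltonianE x y :
  H x y = (e x y)%:R + Q *+ ((x == y) && (y \in [set v; w])).
Proof. by rewrite !mxE !inE; case: eqVneq => //= ->; case: ifP. Qed.

Lemma tr_hamiltonian : (H)^T = H.
Proof.
apply/matrixP => x y; rewrite mxE !hamiltonianE esym [y == x]eq_sym.
by case: eqVneq => [->|].
Qed.

Lemma sum_mul_hamiltonian (f : 'I_n -> R) x :
  \sum_y f y * H y x =
  \sum_(y | e x y) f y + Q *+ (x \in [set v; w]) * f x.
Proof.
under eq_bigr do rewrite hamiltonianE mulrDr.
rewrite big_split /=; congr (_ + _).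
  rewrite [RHS]big_mkcond; apply: eq_bigr => y _.
  by rewrite esym; case: (e x y); rewrite ?mulr1 ?mulr0.
rewrite (bigD1 x) //= eqxx big1 ?addr0 => [|y /negPf ->]; last exact: mulr0.
exact: mulrC.
Qed.

End Hamiltonian.

Section Concentration.
Variables (R : realFieldType) (n k : nat) (e : rel 'I_n) (m : R).
Hypothesis esym : symmetric e.
Hypothesis degree_le : forall x, #|[set y | e x y]|%:R <= m.
Implicit Types (U : 'M[R]_(k, n)) (l : 'rV[R]_k).

Lemma hamiltonian_eigenfunction v w Q U l j :
  eigenframe (hamiltonian e v w Q) U l ->
  eigenfunction e [set v; w] Q (l 0 j) (U j).
Proof.
move=> [_ /matrixP UH] x; have := UH j x; rewrite mul_diag_mx.
rewrite [X in X = _]mxE [X in _ = X]mxE (sum_mul_hamiltonian _ _ _ esym) mulrBl.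
by move=> <-; rewrite addrK.
Qed.

Lemma hamiltonian_pair_vec v w (Q c : R) x :
  (hamiltonian e v w Q *m pair_vec v w c - Q *: pair_vec v w c) x 0 =
  (e v x)%:R + c * (e w x)%:R.
Proof.
rewrite [LHS]mxE [X in _ + X]mxE [X in _ - X]mxE mulmx_pair_vec pair_vecE.
rewrite !hamiltonianE set21 set22 !andbT ![e x _]esym.
by rewrite -2!mulr_natr; ring.
Qed.

Lemma spectral_variance_pair v w Q c U l :
  eigenframe (hamiltonian e v w Q) U l -> c ^+ 2 = 1 ->
  \sum_j (l 0 j - Q) ^+ 2 * spectral_mass U (pair_vec v w c) j <= 4 * m.
Proof.
move=> frame c2.
under eq_bigr do rewrite -(spectral_mass_shift frame).
rewrite (sum_spectral_mass frame) mxE.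
apply: (@le_trans _ _ (\sum_x (2 * (e v x)%:R + 2 * (e w x)%:R))).
  apply: ler_sum => x _; rewrite [_^T _ _]mxE hamiltonian_pair_vec.
  have := sqr_ge0 ((e v x)%:R - c * (e w x)%:R).
  by case: (e v x); case: (e w x) => /=; nra.
rewrite big_split /= -!mulr_sumr.
have := sum_adj_le degree_le v; have := sum_adj_le degree_le w; lra.
Qed.

Lemma spectral_mass_far_le v w Q c U l :
  eigenframe (hamiltonian e v w Q) U l -> c ^+ 2 = 1 -> 0 < Q ->
  \sum_(j | Q / 2 <= `|l 0 j - Q|) spectral_mass U (pair_vec v w c) j
    <= 16 * m / Q ^+ 2.
Proof.
move=> frame c2 Q0; have Q20 : 0 <= Q / 2 by lra.
have := le_trans (chebyshev_sum (l 0) Q (spectral_mass_ge0 U _) Q20)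
  (spectral_variance_pair frame c2).
by rewrite ler_pdivlMr ?exprn_gt0 // exprMn; lra.
Qed.

Lemma parity_mass_concentration s v Q c U l :
  graph_involution e s -> s v != v -> c ^+ 2 = 1 ->
  eigenframe (hamiltonian e v (s v) Q) U l -> 4 * m < Q -> 8 * m < Q ^+ 2 ->
  exists L f,
    [/\ parity_eigenfunction e v (s v) Q c L f, Q / 2 < L &
        \sum_(j | l 0 j != L) spectral_mass U (pair_vec v (s v) c) j
          <= 16 * m / Q ^+ 2].
Proof.
move=> inv sv c2 frame mQ mQ2; set W := spectral_mass U _.
have m0 : 0 <= m := degree_bound_ge0 degree_le v; have Q0 : 0 < Q by lra.
have W0 j : 0 <= W j by apply: spectral_mass_ge0.
have c1 : `|c| <= 1 by rewrite -(@expr_le1 _ 2) // real_normK ?num_real // c2.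
pose far j := Q / 2 <= `|l 0 j - Q|.
have far_mass : \sum_(j | far j) W j <= 16 * m / Q ^+ 2.
  exact: spectral_mass_far_le.
have near_gt j : ~~ far j -> Q / 2 < l 0 j.
  by rewrite -ltNge ltr_norml => /andP[]; lra.
have charged j : W j != 0 -> exists f, parity_eigenfunction e v (s v) Q c (l 0 j) f.
  rewrite /W /spectral_mass mulmx_pair_vec sqrf_eq0.
  have es := graph_involution_mono inv; have [sK _] := inv.
  exact/parity_eigenfunction_symmetrization/(hamiltonian_eigenfunction _ frame).
have [i /andP[iW iQ]] : exists j, (W j != 0) && ~~ far j.
  apply/existsP; apply: contraT; rewrite negb_exists => /forallP all_far.
  suff : 1 + c ^+ 2 <= 16 * m / Q ^+ 2.
    by rewrite c2 ler_pdivlMr ?exprn_gt0 //; lra.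
  rewrite -(sum_spectral_mass_pair frame _ sv); apply: le_trans far_mass.
  apply: ler_sum_support => // j _ Wj.
  by have := all_far j; rewrite Wj /= negbK.
have [f pf] := charged i iW; exists (l 0 i), f; split=> //; first exact: near_gt.
apply: le_trans far_mass; apply: ler_sum_support => // j lj /charged[g pg].
apply: contraNT lj => near_j; apply/eqP.
have [li lj] := (near_gt _ iQ, near_gt _ near_j).
by apply: (parity_eigenvalue_unique degree_le c1 _ _ pg pf); lra.
Qed.

End Concentration.

(** * Transfer probability *)

Section Evolution.
Variables (R : realType) (n k : nat).
Variables (H : 'M[R]_n) (U : 'M[R]_(k, n)) (l : 'rV[R]_k).
Hypothesis frame : eigenframe H U l.

Lemma lim_series_mxpow (c : nat -> R) (g : R -> R) x y :
  (forall z, (series (fun p => c p * z ^+ p) @ \oo --> g z)%classic) ->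
  limn (series (fun p => c p * mxpow H p x y)) = \sum_j U j x * U j y * g (l 0 j).
Proof.
move=> cg; apply/cvg_lim => //.
have -> : series (fun p => c p * mxpow H p x y) = fun N =>
    \sum_j U j x * U j y * series (fun p => c p * l 0 j ^+ p) N.
  apply/funext => N; rewrite /series /=.
  under [RHS]eq_bigr do rewrite mulr_sumr.
  rewrite exchange_big; apply: eq_bigr => p _ /=.
  rewrite (mxpow_eigenframe frame) mulr_sumr.
  by apply: eq_bigr => j _; rewrite mulrCA.
by apply: cvg_big => [|j _]; [exact: add_continuous | apply: cvgMl_tmp].
Qed.

Lemma expitH_re_eigenframe t x y :
  expitH_re H t x y = \sum_j U j x * U j y * cos (t * l 0 j).
Proof.
apply: (lim_series_mxpow (g := fun z => cos (t * z))) => z.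
rewrite (_ : (fun _ => _) = cos_coeff (t * z)).
  by rewrite unlock; apply: is_cvg_series_cos_coeff.
apply/funext => p; rewrite /cos_coeff /= exprMn; case: odd => /=.
  by rewrite !mul0r.
by rewrite -exprnP; ring.
Qed.

Lemma expitH_im_eigenframe t x y :
  expitH_im H t x y = \sum_j U j x * U j y * sin (t * l 0 j).
Proof.
apply: (lim_series_mxpow (g := fun z => sin (t * z))) => z.
rewrite (_ : (fun _ => _) = sin_coeff (t * z)).
  by rewrite unlock; apply: is_cvg_series_sin_coeff.
apply/funext => p; rewrite /sin_coeff /= exprMn; case: p => [|p] /=.
  by rewrite !mul0r.
by rewrite uphalf_half; case: odd => /=; rewrite ?mul0r //; ring.
Qed.

(* The left-hand side is the square of the component of the amplitude along the
   unit vector [i * exp (i * a)]. *)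
Lemma shifted_sum_le_transfer_prob t a x y :
  (\sum_j U j x * U j y * sin (t * l 0 j - a)) ^+ 2 <= transfer_prob H x y t.
Proof.
rewrite /transfer_prob expitH_re_eigenframe expitH_im_eigenframe.
set C := \sum_j _ * cos _; set S := \sum_j _ * sin (t * l _ _).
have -> : \sum_j U j x * U j y * sin (t * l 0 j - a) = S * cos a - C * sin a.
  rewrite !mulr_suml -sumrB; apply: eq_bigr => j _.
  by rewrite sinB; ring.
have -> : C ^+ 2 + S ^+ 2 = (S * cos a - C * sin a) ^+ 2
    + (C * cos a + S * sin a) ^+ 2.
  by rewrite -[LHS]mulr1 -(cos2Dsin2 a); ring.
by rewrite lerDl sqr_ge0.
Qed.

End Evolution.

Lemma norm_sin_le (R : realType) (x : R) : `|sin x| <= `|x|.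
Proof.
wlog x0 : x / 0 <= x.
  move=> IH; have [/IH //|/ltW x0] := leP 0 x.
  by rewrite -normrN -sinN -[leRHS]normrN IH ?oppr_ge0.
have [c _] : exists2 c, c \in `[0, x] & sin x - sin 0 = cos c * (x - 0).
  apply: MVT_segment => //; apply: continuous_subspaceT => z.
  exact: continuous_sin.
by rewrite sin0 !subr0 => ->; rewrite normrM ler_piMl // cos_max.
Qed.

Lemma cos_ge_quadratic (R : realType) (x : R) : 1 - x ^+ 2 / 2 <= cos x.
Proof.
have -> : cos x = 1 - 2 * sin (x / 2) ^+ 2.
  rewrite [in LHS](_ : x = (x / 2) *+ 2); last by rewrite mulr2n; lra.
  by rewrite cos_mulr2n cos2sin2 mulr2n; lra.
have : sin (x / 2) ^+ 2 <= (x / 2) ^+ 2.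
  by rewrite -(real_normK (num_real (sin _))) -(real_normK (num_real (x / 2)))
    lerXn2r ?nnegrE ?norm_sin_le.
by rewrite exprMn; lra.
Qed.

Lemma sin_pihalf_ge (R : realType) (x : R) :
  0 <= x -> 1 - 2 * x ^+ 2 <= sin ((1 - x) * (pi / 2)).
Proof.
move=> x0; have -> : (1 - x) * (pi / 2) = - (x * (pi / 2)) + pi / 2 by ring.
rewrite sinDpihalf cosN; apply: le_trans (cos_ge_quadratic _).
have pi2 := pihalf_lt2 R; have pi0 := pihalf_ge1 R.
have : (x * (pi / 2)) ^+ 2 <= (x * 2) ^+ 2.
  by rewrite lerXn2r ?nnegrE ?mulr_ge0 //; [lra|rewrite ler_wpM2l //; lra].
by rewrite [in leRHS]exprMn; lra.
Qed.

Lemma ge_sum_concentrated (R : realDomainType) (J : finType) (P : pred J)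
    (W g : J -> R) c :
  (forall j, 0 <= W j) -> (forall j, -1 <= g j) -> c <= 1 ->
  (forall j, ~~ P j -> g j = c) ->
  c * (\sum_j W j) - 2 * (\sum_(j | P j) W j) <= \sum_j W j * g j.
Proof.
move=> W0 g1 c1 gc; rewrite lerBlDr -lerBlDl mulr_sumr mulr_sumr -sumrB.
rewrite [leLHS](bigID P) /= [X in _ + X]big1 ?addr0 => [|j /gc ->]; last ring.
by apply: ler_sum => j _; have := W0 j; have := g1 j; nra.
Qed.

(* With the phase [t * (L1 + L2) / 2] removed, the phases of the two levels are
   opposite. *)
Lemma transfer_prob_two_level_ge (R : realType) n k (H : 'M[R]_n) (U : 'M[R]_(k, n))
    (l : 'rV[R]_k) v w L1 L2 h t :
  eigenframe H U l -> w != v ->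
  \sum_(j | l 0 j != L1) spectral_mass U (pair_vec v w 1) j <= h ->
  \sum_(j | l 0 j != L2) spectral_mass U (pair_vec v w (-1)) j <= h ->
  h <= sin (t * (L1 - L2) / 2) ->
  (sin (t * (L1 - L2) / 2) - h) ^+ 2 <= transfer_prob H v w t.
Proof.
move=> frame wv h1 h2; set c := sin _ => hc; pose a := t * (L1 + L2) / 2.
apply: le_trans (shifted_sum_le_transfer_prob frame t a v w).
pose g j := sin (t * l 0 j - a).
suff : c - h <= \sum_j U j v * U j w * g j.
  by move=> cS; rewrite lerXn2r ?nnegrE //; lra.
have mass0 z j : 0 <= spectral_mass U (pair_vec v w z) j := spectral_mass_ge0 U _ j.
have sum1 : 2 * c - 2 * h <= \sum_j spectral_mass U (pair_vec v w 1) j * g j.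
  apply: le_trans (ge_sum_concentrated (P := fun j => l 0 j != L1) (c := c)
    (mass0 1) (fun j => sin_geN1 _) (sin_le1 _) _).
    by rewrite (sum_spectral_mass_pair frame) // expr1n; lra.
  move=> j; rewrite negbK => /eqP lj; rewrite /g lj; congr sin.
  by rewrite /a; field.
have sum2 : 2 * c - 2 * h <= - \sum_j spectral_mass U (pair_vec v w (-1)) j * g j.
  rewrite -sumrN; under eq_bigr do rewrite -mulrN.
  apply: le_trans (ge_sum_concentrated (P := fun j => l 0 j != L2) (c := c)
    (mass0 (-1)) _ (sin_le1 _) _) => [|j|j].
  - by rewrite (sum_spectral_mass_pair frame) // sqrrN expr1n; lra.
  - by rewrite lerN2 sin_le1.
  - rewrite negbK => /eqP lj; rewrite /g lj -sinN; congr sin.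
    by rewrite /a; field.
have := spectral_mass_polarization U v w g; lra.
Qed.

Lemma transfer_prob_half_period_ge (R : realType) n k (H : 'M[R]_n)
    (U : 'M[R]_(k, n)) (l : 'rV[R]_k) v w L1 L2 eps :
  eigenframe H U l -> w != v -> L1 != L2 -> 0 <= eps <= 1 ->
  \sum_(j | l 0 j != L1) spectral_mass U (pair_vec v w 1) j <= eps / 8 ->
  \sum_(j | l 0 j != L2) spectral_mass U (pair_vec v w (-1)) j <= eps / 8 ->
  1 - eps <= transfer_prob H v w ((1 - eps / 4) * pi / (L1 - L2)).
Proof.
move=> frame wv L12 /andP[eps0 eps1] mass1 mass2; set t := _ / (L1 - L2).
have tD : t * (L1 - L2) / 2 = (1 - eps / 4) * (pi / 2).
  by rewrite divfK ?subr_eq0 // mulrA.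
have : 1 - 2 * (eps / 4) ^+ 2 <= sin (t * (L1 - L2) / 2).
  by rewrite tD sin_pihalf_ge // divr_ge0.
rewrite exprMn => sin_ge; have eps2 : eps ^+ 2 <= eps by rewrite expr2 ler_piMl.
apply: le_trans (transfer_prob_two_level_ge frame wv mass1 mass2 _); last by lra.
apply: (@le_trans _ _ ((1 - eps / 4) ^+ 2)).
  by have := sqr_ge0 (eps / 4); lra.
by rewrite lerXn2r ?nnegrE //; lra.
Qed.

Lemma half_period_lt (R : realType) (D T r x : R) :
  0 < T -> 0 < D -> r <= x -> 0 < x < 1 -> 2 / T <= (1 + r) * D ->
  0 < (1 - x) * pi / D < pi / 2 * T.
Proof.
move=> T0 D0 rx /andP[x0 x1]; have pi0 := pi_gt0 R.
rewrite ler_pdivrMr // => DT; rewrite -mulrA in DT.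
have DT0 : 0 < D * T by rewrite mulr_gt0.
have xDT : (1 - x) * 2 < D * T by nra.
apply/andP; split; first by rewrite divr_gt0 // mulr_gt0 //; lra.
by rewrite ltr_pdivrMr //; move: xDT; rewrite -(ltr_pM2l pi0); lra.
Qed.

Lemma strong_potential_bounds (R : realFieldType) (m eps Q : R) :
  0 <= m -> 0 < eps < 1 -> 256 * (m + 1) <= Q * eps ^+ 2 ->
  [/\ 4 * m < Q, 8 * m < Q ^+ 2, 16 * m / Q ^+ 2 <= eps / 8 &
      forall L1 L2, Q / 2 < L1 -> Q / 2 < L2 ->
        m * response m L1 L2 <= eps / 4].
Proof.
move=> m0 /andP[eps0 eps1] Qeps2.
have Q0 : 0 < Q by rewrite -(@pmulr_lgt0 _ (eps ^+ 2)) ?exprn_gt0 //; lra.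
have Qeps : 256 * (m + 1) <= Q * eps.
  apply: le_trans Qeps2 _; rewrite ler_pM2l // expr2; nra.
have Q256 : 256 * (m + 1) <= Q.
  apply: le_trans Qeps _; nra.
have QmQ : 256 * (m + 1) * Q <= eps * Q ^+ 2 by nra.
split=> [||| L1 L2 L1Q L2Q]; first lra; first nra.
  by rewrite ler_pdivrMr ?exprn_gt0 //; nra.
have L12_ge : Q / 2 * (Q / 4) <= L1 * (L2 - m) by rewrite ler_pM //; lra.
have L12 : 0 < L1 * (L2 - m) by rewrite mulr_gt0 //; lra.
rewrite mulrA ler_pdivrMr //; nra.
Qed.

Theorem theorem3 (R : realType) (n : nat) (e : rel 'I_n) (s : 'I_n -> 'I_n)
  (v : 'I_n) (d : nat) (Q eps : R) :
  simple_graph e -> connected_graph e -> graph_involution e s ->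
  s v != v -> graph_dist e v (s v) d ->
  0 < eps < 1 ->
  Q >= 256 * ((max_degree e)%:R + 1) / eps ^+ 2 ->
  exists t : R,
    0 < t < pi / 2 * (Q + (max_degree e)%:R) ^+ d.-1 /\
    transfer_prob (hamiltonian e v (s v) Q) v (s v) t >= 1 - eps.
Proof.
move=> [esym _] _ inv sv dist eps01; have [eps0 _] := andP eps01.
rewrite ler_pdivrMr ?exprn_gt0 //; set m := (max_degree e)%:R => Qeps.
have m0 : 0 <= m := ler0n _ _.
have [mQ mQ2 small_mass small_gap] := strong_potential_bounds m0 eps01 Qeps.
have degree_le : forall x, #|[set y | e x y]|%:R <= m := degree_le_max_degree R e.
have [U [l frame]] := symmetric_eigenframe (tr_hamiltonian v (s v) Q esym).
have concentrated c (c2 : c ^+ 2 = 1) :=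
  parity_mass_concentration esym degree_le inv sv c2 frame mQ mQ2.
have [L1 [f1 [pf1 L1Q /le_trans/(_ small_mass) mass1]]] :=
  concentrated 1 (expr1n R 2).
have [L2 [f2 [pf2 L2Q /le_trans/(_ small_mass) mass2]]] :=
  concentrated (-1) (etrans (sqrrN 1) (expr1n R 2)).
have [q [sq pq qw qS]] := graph_dist_path sv dist.
have [mL1 mL2] : 2 * m < L1 /\ 2 * m < L2 by lra.
have [D0 gap] := parity_gap degree_le esym mL1 mL2 pf1 pf2 pq qS qw.
have T0 : 0 < (Q + m) ^+ size q by rewrite exprn_gt0 //; lra.
exists ((1 - eps / 4) * pi / (L1 - L2)); split.
  rewrite -sq; apply: half_period_lt T0 D0 (small_gap _ _ L1Q L2Q) _ gap; lra.
apply: (transfer_prob_half_period_ge frame sv _ _ mass1 mass2); last by lra.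
by rewrite -subr_eq0 gt_eqF.
Qed.
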